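(* Let $(M,J,\Omega,\theta)$ be a compact connected Vaisman manifold with $\|\theta\|^2=1$ and Lee vector field $B$. Suppose that the flow of $B$ satisfies $\Phi_B^{2\pi}=\mathrm{id}_M$ and that there is a diffeomorphism $M\cong N\times\mathbb{S}^1$, with $N$ a compact Sasaki manifold and $\mathbb{S}^1=\mathbb{R}/2\pi\mathbb{Z}$ with coordinate $t$, under which $B$ corresponds to $\frac{d}{dt}$ and $\theta$ to $dt$. Let $f$ be the function on $M$ induced by a non-constant smooth function on $\mathbb{S}^1$ which is everywhere $>-1$ (so that $df=B(f)\theta$). Then the LCK metric with fundamental form $$\Omega'=\Omega+f\,\theta\wedge J\theta$$ and Lee form $\theta'=(1+f)\theta$ admits a positive potential, i.e. there exists $g\in C^\infty(M,\mathbb{R})$, $g>0$ everywhere, with $\Omega'=d_{\theta'}d^c_{\theta'}g$.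
   Context: A Hermitian metric with fundamental form $\Omega=g(J\cdot,\cdot)$ on $(M,J)$ is LCK with Lee form $\theta$ (real, closed) if $d\Omega=\theta\wedge\Omega$; it is Vaisman if $\theta$ is parallel for the Levi-Civita connection. The Lee vector field $B$ is the metric dual of $\theta$. For a one-form $\alpha$ put $J\alpha=-\alpha\circ J$; for a function $u$ put $d^cu=J\,du$. Set $d_{\theta}\eta=d\eta-\theta\wedge\eta$ on forms and $d^c_{\theta}u=d^cu-uJ\theta$ on functions. With $\|\theta\|=1$ a Vaisman metric satisfies $\Omega=-dJ\theta+\theta\wedge J\theta$, and consequently $\Omega'=-dJ\theta+(1+f)\theta\wedge J\theta=d_{(1+f)\theta}(-J\theta)$ is a positive $(1,1)$-form with $d\Omega'=\theta'\wedge\Omega'$. *)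

(* Defs.v *)
From HB Require Import structures.
From mathcomp Require Import all_boot all_order all_algebra.
From mathcomp Require Import all_classical all_reals all_analysis.
From mathcomp Require Import ring.

Set Implicit Arguments.
Unset Strict Implicit.
Unset Printing Implicit Defensive.

Import Order.TTheory GRing.Theory Num.Theory.
Import numFieldNormedType.Exports.

Local Open Scope classical_set_scope.
Local Open Scope ring_scope.

(* [Ck k f x]: f is of class C^k on some neighbourhood of x. *)
Fixpoint Ck (R : realType) (n k : nat) (f : 'rV[R]_n -> R) (x : 'rV[R]_n) : Prop :=
  (\forall y \near x, {for y, continuous f}) /\
  match k with
  | 0 => True
  | k'.+1 => forall i : 'I_n,
      (\forall y \near x, derivable f y (delta_mx 0 i)) /\
      Ck k' (fun y => 'D_(delta_mx 0 i) f y) x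
  end.

Section CkTheory.
Context {R : realType} {n : nat}.
Implicit Types (f g : 'rV[R]_n -> R) (x : 'rV[R]_n).

Lemma Ck_ext k f g x : (\forall y \near x, f y = g y) -> Ck k f x -> Ck k g x.
Proof.
have cont (u v : 'rV[R]_n -> R) : (\forall y \near x, u y = v y) ->
    (\forall y \near x, {for y, continuous u}) ->
    \forall y \near x, {for y, continuous v}.
  move=> /near_join uv cu; near=> y.
  have e : \forall z \near y, u z = v z by near: y.
  have c : {for y, continuous u} by near: y.
  rewrite /prop_for /continuous_at -(nbhs_singleton e).
  exact: (cvg_trans (near_eq_cvg e) c).
elim: k f g => [|k IH] f g fg /= [cf H]; split => //; try exact: cont cf.
move=> i; have [d Dk] := H i; have fg2 := near_join fg; split.
  near=> y; have e : \forall z \near y, f z = g z by near: y.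
  have c : derivable f y (delta_mx 0 i) by near: y.
  exact: near_eq_derivable e c.
apply: IH Dk; near=> y.
have e : \forall z \near y, f z = g z by near: y.
by apply: near_eq_derive; exact: e.
Unshelve. all: by end_near. Qed.

Lemma Ck_le k f x : Ck k.+1 f x -> Ck k f x.
Proof.
elim: k f => [|k IH] f /= [cf H]; split => // i.
by have [d Dk] := H i; split=> //; apply: IH.
Qed.

Lemma Ck_cst k (c : R) x : Ck k (fun=> c) x.
Proof.
elim: k c => [|k IH] c /=; split => //; try by near=> y; exact: cst_continuous.
move=> i; split; first by near=> y; exact: derivable_cst.
apply: (Ck_ext (f := fun=> 0)) (IH 0).
by near=> y; rewrite derive_cst.
Unshelve. all: by end_near. Qed.

Lemma CkD k f g x : Ck k f x -> Ck k g x -> Ck k (f + g) x.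
Proof.
have cont (u v : 'rV[R]_n -> R) :
    (\forall y \near x, {for y, continuous u}) ->
    (\forall y \near x, {for y, continuous v}) ->
    \forall y \near x, {for y, continuous (u + v)}.
  by move=> cu cv; apply: filterS2 cu cv => y cuy cvy; exact: continuousD.
elim: k f g => [|k IH] f g /= [cf Hf] [cg Hg]; split => //; try exact: cont.
move=> i; have [df Df] := Hf i; have [dg Dg] := Hg i; split.
  apply: filterS2 df dg => y dfy dgy.
  exact: (@derivableD _ _ _ f g y _ dfy dgy).
apply: Ck_ext (IH _ _ Df Dg).
apply: filterS2 df dg => y dfy dgy.
by rewrite (@deriveD _ _ _ f g y _ dfy dgy).
Qed.

Lemma CkM k f g x : Ck k f x -> Ck k g x -> Ck k (f * g) x.
Proof.
have cont (u v : 'rV[R]_n -> R) :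
    (\forall y \near x, {for y, continuous u}) ->
    (\forall y \near x, {for y, continuous v}) ->
    \forall y \near x, {for y, continuous (u * v)}.
  by move=> cu cv; apply: filterS2 cu cv => y cuy cvy; exact: continuousM.
elim: k f g => [|k IH] f g Cf Cg.
  by case: Cf Cg => [cf _] [cg _]; split => //; exact: cont.
have [[cf Hf] [cg Hg]] := (Cf, Cg).
split; first exact: cont.
move=> i; have [df Df] := Hf i; have [dg Dg] := Hg i; split.
  apply: filterS2 df dg => y dfy dgy.
  exact: (@derivableM _ _ f g y _ dfy dgy).
apply: Ck_ext (CkD (IH _ _ (Ck_le Cf) Dg) (IH _ _ (Ck_le Cg) Df)).
apply: filterS2 df dg => y dfy dgy.
by rewrite (@deriveM _ _ f g y _ dfy dgy).
Qed.

End CkTheory.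

Record chart (R : realType) (T : Type) (n : nat) := Chart {
  chart_dom : set T;
  chart_map : T -> 'rV[R]_n;
  chart_inv : 'rV[R]_n -> T }.

(* A topological space with a family of charts; this is a smooth manifold
   under [is_manifold] below. *)
Record smooth_space (R : realType) := Space {
  space_sort :> topologicalType;
  space_dim : nat;
  atlas : set (chart R space_sort space_dim) }.

Definition chart_img (R : realType) (M : smooth_space R) (c : chart R M (space_dim M)) :=
  chart_map c @` chart_dom c.

Definition is_chart (R : realType) (M : smooth_space R) (c : chart R M (space_dim M)) :=
  [/\ open (chart_dom c), open (chart_img c),
      {in chart_dom c, cancel (chart_map c) (chart_inv c)},
      (forall x, chart_dom c x -> {for x, continuous (chart_map c)}) &
      (forall v, chart_img c v -> {for v, continuous (chart_inv c)})].

Definition chart_compat (R : realType) (M : smooth_space R)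
    (c d : chart R M (space_dim M)) :=
  forall x, chart_dom c x -> chart_dom d x -> forall i k,
    Ck k (fun v => chart_map d (chart_inv c v) 0 i) (chart_map c x).

Definition is_manifold (R : realType) (M : smooth_space R) :=
  [/\ hausdorff_space M, @second_countable M,
      (forall c, atlas c -> is_chart (M := M) c),
      (forall x : M, exists2 c, atlas c & chart_dom c x) &
      (forall c d, atlas c -> atlas d -> chart_compat (M := M) c d)].

Definition smooth (R : realType) (M : smooth_space R) (f : M -> R) :=
  forall c, atlas c -> forall v, chart_img (M := M) c v ->
  forall k, Ck k (f \o chart_inv c) v.

Definition smooth_pred (R : realType) (M : smooth_space R) : {pred M -> R^o} :=
  fun f => `[< smooth (M := M) f >].

Record smooth_fun (R : realType) (M : smooth_space R) := SmoothFun {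
  smooth_val :> M -> R^o;
  smooth_valP : smooth_pred smooth_val }.

Section SmoothFun.
Context (R : realType) (M : smooth_space R).

HB.instance Definition _ := [isSub for @smooth_val R M].
HB.instance Definition _ := [Choice of smooth_fun M by <:].

Lemma smooth_cst (a : R) : smooth (M := M) (fun=> a).
Proof. by move=> c _ v _ k; exact: Ck_cst. Qed.

Lemma smoothD (f g : M -> R) : smooth f -> smooth g -> smooth (f + g).
Proof. by move=> sf sg c Ac v cv k; apply: CkD; [exact: sf|exact: sg]. Qed.

Lemma smoothM (f g : M -> R) : smooth f -> smooth g -> smooth (f * g).
Proof. by move=> sf sg c Ac v cv k; apply: CkM; [exact: sf|exact: sg]. Qed.

Lemma smooth_subring_closed : subring_closed (@smooth_pred R M).
Proof.
split => [|f g /asboolP sf /asboolP sg|f g /asboolP sf /asboolP sg].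
- by apply/asboolP; exact: smooth_cst.
- apply/asboolP; have -> : f - g = f + (fun=> -1) * g.
    by apply/funext => x; rewrite -[RHS]/(f x + (-1) * g x) mulN1r.
  by apply: smoothD => //; apply: smoothM => //; exact: smooth_cst.
- by apply/asboolP; exact: smoothM.
Qed.

HB.instance Definition _ :=
  GRing.isSubringClosed.Build (M -> R^o) (@smooth_pred R M)
    smooth_subring_closed.

Lemma smooth_scaler_closed : GRing.scaler_closed (@smooth_pred R M).
Proof.
move=> a f /asboolP sf; apply/asboolP.
by apply: (@smoothM (fun=> a)) => //; exact: smooth_cst.
Qed.

HB.instance Definition _ :=
  GRing.isScaleClosed.Build R (M -> R^o) (@smooth_pred R M)
    smooth_scaler_closed.

HB.instance Definition _ := 
  GRing.SubChoice_isSubComPzRing.Build _ _ (smooth_fun M)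
    smooth_subring_closed.
HB.instance Definition _ := [SubZmodule_isSubLmodule of smooth_fun M by <:].

Lemma smooth_funP (u : smooth_fun M) : smooth u.
Proof. exact/asboolP/(valP u). Qed.

Lemma smooth_fun_eqP (u v : smooth_fun M) : u = v <-> forall x, u x = v x.
Proof. by split=> [-> //|uv]; exact/val_inj/funext. Qed.
End SmoothFun.

(* Vector fields are the R-linear derivations of C^oo(M). *)

Definition derivation (R : realType) (M : smooth_space R)
    (D : smooth_fun M -> smooth_fun M) :=
  linear D /\ forall u v, D (u * v) = D u * v + u * D v.

Definition derivation_pred (R : realType) (M : smooth_space R) :
  {pred smooth_fun M -> (smooth_fun M)^o} := fun D => `[< derivation D >].

Record vfield (R : realType) (M : smooth_space R) := VField {
  vfield_val :> smooth_fun M -> (smooth_fun M)^o;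
  vfield_valP : derivation_pred vfield_val }.

Section VField.
Context (R : realType) (M : smooth_space R).
Local Notation C := (smooth_fun M).

HB.instance Definition _ := [isSub for @vfield_val R M].
HB.instance Definition _ := [Choice of vfield M by <:].

Lemma derivation_submod_closed : submod_closed (@derivation_pred R M).
Proof.
split => [|a D E /asboolP[Dl DM] /asboolP[El EM]]; apply/asboolP; split.
- by move=> k u v; rewrite scaler0 addr0.
- by move=> u v; rewrite mulr0 mul0r addr0.
- move=> k u v; rewrite -[LHS]/(a * D (k *: u + v) + E (k *: u + v)).
  rewrite -[RHS]/(k *: (a * D u + E u) + (a * D v + E v)) Dl El.
  apply/smooth_fun_eqP => x.
  rewrite -[LHS]/(a x * (k * D u x + D v x) + (k * E u x + E v x)).
  rewrite -[RHS]/(k * (a x * D u x + E u x) + (a x * D v x + E v x)).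
  by rewrite mulrDr mulrDr addrACA mulrCA.
- move=> u v; rewrite -[LHS]/(a * D (u * v) + E (u * v)).
  rewrite -[RHS]/((a * D u + E u) * v + u * (a * D v + E v)) DM EM.
  by rewrite mulrDl !mulrDr addrACA mulrA (mulrCA u).
Qed.

HB.instance Definition _ :=
  GRing.isSubmodClosed.Build C (C -> C^o) (@derivation_pred R M)
    derivation_submod_closed.
HB.instance Definition _ := [SubChoice_isSubLmodule of vfield M by <:].

Lemma vfieldP (X : vfield M) : derivation X.
Proof. exact/asboolP/(valP X). Qed.

Lemma vfield_eqP (X Y : vfield M) : X = Y <-> forall u, X u = Y u.
Proof. by split=> [-> //|XY]; exact/val_inj/funext. Qed.

Lemma lie_proof (X Y : vfield M) :
  derivation_pred (fun u => X (Y u) - Y (X u)).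
Proof.
have [Xl XM] := vfieldP X; have [Yl YM] := vfieldP Y.
have XD u v : X (u + v) = X u + X v by have := Xl 1 u v; rewrite !scale1r.
have YD u v : Y (u + v) = Y u + Y v by have := Yl 1 u v; rewrite !scale1r.
apply/asboolP; split=> [k u v|u v].
  rewrite Xl Yl Xl Yl scalerBr; rewrite !opprD; exact: addrACA.
rewrite XM YM XD YD !XM !YM; apply/smooth_fun_eqP => x.
set a := X (Y u); set b := Y (X u); set c := X (Y v); set d := Y (X v).
rewrite -[LHS]/(a x * v x + Y u x * X v x + (X u x * Y v x + u x * c x) -
  (b x * v x + X u x * Y v x + (Y u x * X v x + u x * d x))).
rewrite -[RHS]/((a x - b x) * v x + u x * (c x - d x)).
ring.
Qed.

Definition lie (X Y : vfield M) : vfield M := VField (lie_proof X Y).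
End VField.

(* Tensor fields are C^oo(M)-multilinear maps on vector fields; wedge products
   and exterior derivatives carry no 1/k! factors. *)

Section Forms.
Context (R : realType) (M : smooth_space R).
Local Notation C := (smooth_fun M).
Local Notation X := (vfield M).

Definition is_form1 (alpha : X -> C) := scalar alpha.

Definition is_bilinear (b : X -> X -> C) :=
  (forall Y, scalar (b Y)) /\ (forall Z, scalar (b^~ Z)).

Definition d0 (u : C) : X -> C := fun Y => Y u.

Definition d1 (alpha : X -> C) : X -> X -> C := fun Y Z =>
  Y (alpha Z) - Z (alpha Y) - alpha (lie Y Z).

Definition d2 (w : X -> X -> C) : X -> X -> X -> C := fun Y Z T =>
  Y (w Z T) - Z (w Y T) + T (w Y Z)
  - w (lie Y Z) T + w (lie Y T) Z - w (lie Z T) Y.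

Definition wedge11 (alpha beta : X -> C) : X -> X -> C := fun Y Z =>
  alpha Y * beta Z - alpha Z * beta Y.

Definition wedge12 (alpha : X -> C) (w : X -> X -> C) : X -> X -> X -> C :=
  fun Y Z T => alpha Y * w Z T - alpha Z * w Y T + alpha T * w Y Z.

Definition actJ (J : X -> X) (alpha : X -> C) : X -> C := fun Y => - alpha (J Y).

Definition dc (J : X -> X) (u : C) : X -> C := actJ J (d0 u).

(* d_theta on one-forms, d^c_theta on functions. *)
Definition dtw (theta alpha : X -> C) : X -> X -> C := fun Y Z =>
  d1 alpha Y Z - wedge11 theta alpha Y Z.

Definition dctw (J : X -> X) (theta : X -> C) (u : C) : X -> C := fun Y =>
  dc J u Y - u * actJ J theta Y.

Definition is_metric (g : X -> X -> C) :=
  [/\ is_bilinear g, (forall Y Z, g Y Z = g Z Y),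
      (forall Y x, 0 <= g Y Y x) &
      (* if g_x(Y_x, Y_x) = 0 then Y_x = 0; the converse follows from
         bilinearity *)
      (forall (Y : X) x, g Y Y x = 0 -> forall u, Y u x = 0)].

Definition is_complex_structure (J : X -> X) :=
  [/\ linear J, (forall Y, J (J Y) = - Y) &
      (* integrability: the Nijenhuis tensor vanishes *)
      (forall Y Z, lie (J Y) (J Z) - J (lie (J Y) Z) - J (lie Y (J Z))
                   - lie Y Z = 0)].

Definition is_hermitian (J : X -> X) (g : X -> X -> C) :=
  is_metric g /\ forall Y Z, g (J Y) (J Z) = g Y Z.

Definition fundamental_form (J : X -> X) (g : X -> X -> C) : X -> X -> C :=
  fun Y Z => g (J Y) Z.

Definition is_lck (J : X -> X) (g : X -> X -> C) (theta : X -> C) :=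
  [/\ is_hermitian J g, is_form1 theta,
      (forall Y Z, d1 theta Y Z = 0) &
      (forall Y Z T, d2 (fundamental_form J g) Y Z T
                     = wedge12 theta (fundamental_form J g) Y Z T)].

Definition is_levi_civita (g : X -> X -> C) (nabla : X -> X -> X) :=
  [/\ (forall Z, linear (nabla^~ Z)),
      (forall Y Z T, nabla Y (Z + T) = nabla Y Z + nabla Y T),
      (forall (Y : X) (u : C) (Z : X), nabla Y (u *: Z) = Y u *: Z + u *: nabla Y Z),
      (forall Y Z, nabla Y Z - nabla Z Y = lie Y Z) &
      (forall Y Z T : X, Y (g Z T) = g (nabla Y Z) T + g Z (nabla Y T))].

Definition is_vaisman (J : X -> X) (g : X -> X -> C) (theta : X -> C) :=
  is_lck J g theta /\
  exists2 nabla, is_levi_civita g nabla &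
    forall Y Z : X, Y (theta Z) - theta (nabla Y Z) = 0.

(* With B metric dual to alpha, the squared norm of alpha is g B B. *)
Definition metric_dual (g : X -> X -> C) (alpha : X -> C) (B : X) :=
  forall Y, g B Y = alpha Y.

(* (phi, xi, eta, g) is a Sasakian structure, i.e. a normal contact metric structure.
   With this normalisation of d, the factor 2 is the one for which the
   metric cone dr^2 + r^2 g is Kaehler. *)
Definition is_sasaki (phi : X -> X) (xi : X) (eta : X -> C)
    (g : X -> X -> C) :=
  [/\ is_metric g,
      [/\ linear phi, is_form1 eta, eta xi = 1 &
          forall Y, phi (phi Y) = - Y + eta Y *: xi],
      (forall Y Z, g (phi Y) (phi Z) = g Y Z - eta Y * eta Z),
      (forall Y Z, d1 eta Y Z = g Y (phi Z) *+ 2) &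
      (forall Y Z, phi (phi (lie Y Z)) + lie (phi Y) (phi Z)
         - phi (lie (phi Y) Z) - phi (lie Y (phi Z)) + d1 eta Y Z *: xi = 0)].

Definition is_lck_form (J : X -> X) (Omega : X -> X -> C) (theta : X -> C) :=
  exists2 g, is_lck J g theta &
    forall Y Z, fundamental_form J g Y Z = Omega Y Z.

Definition has_positive_potential (J : X -> X) (Omega : X -> X -> C)
    (theta : X -> C) :=
  exists2 u : C, (forall x, 0 < u x) &
    forall Y Z, Omega Y Z = dtw theta (dctw J theta u) Y Z.

Definition is_flow (B : X) (Phi : R -> M -> M) :=
  (forall x, Phi 0 x = x) /\
  forall (x : M) (t : R) (u : C),
    is_derive t 1 (fun s => u (Phi s x) : R) (B u (Phi t x)).

End Forms.

(* F is smooth iff it pulls smooth functions back to smooth functions; between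
   manifolds this agrees with smoothness in charts, by bump functions. *)
Definition smooth_map (R : realType) (M N : smooth_space R) (F : M -> N) :=
  forall u : smooth_fun N, smooth (M := M) (u \o F).

Record diffeo (R : realType) (M N : smooth_space R) := Diffeo {
  diffeo_fun :> M -> N;
  diffeo_inv : N -> M;
  diffeo_funK : cancel diffeo_fun diffeo_inv;
  diffeo_invK : cancel diffeo_inv diffeo_fun;
  diffeo_smooth : smooth_map diffeo_fun;
  diffeo_inv_smooth : smooth_map diffeo_inv }.

Section Pushforward.
Context (R : realType).

Definition pull_fun (M N : smooth_space R) (F : M -> N) (sF : smooth_map F)
  (u : smooth_fun N) : smooth_fun M := SmoothFun (asboolT (sF u)).

Definition diffeo_sym (M N : smooth_space R) (F : diffeo M N) : diffeo N M :=
  Diffeo (diffeo_invK F) (diffeo_funK F) (diffeo_inv_smooth F)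
    (diffeo_smooth F).

Context (M N : smooth_space R) (F : diffeo M N).

Lemma push_vfield_proof (X : vfield M) :
  derivation_pred (fun u =>
    pull_fun (diffeo_inv_smooth F) (X (pull_fun (diffeo_smooth F) u))).
Proof.
have [Xl XM] := vfieldP X; apply/asboolP; split.
- move=> k u v; have -> : pull_fun (diffeo_smooth F) (k *: u + v) =
    k *: pull_fun (diffeo_smooth F) u + pull_fun (diffeo_smooth F) v.
    exact/smooth_fun_eqP.
  by rewrite Xl; exact/smooth_fun_eqP.
- move=> u v; have -> : pull_fun (diffeo_smooth F) (u * v) =
    pull_fun (diffeo_smooth F) u * pull_fun (diffeo_smooth F) v.
    exact/smooth_fun_eqP.
  rewrite XM; apply/smooth_fun_eqP => x.
  set a := X _; set b := X _.
  rewrite -[LHS]/(a (diffeo_inv F x) * v (F (diffeo_inv F x)) +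
                  u (F (diffeo_inv F x)) * b (diffeo_inv F x)).
  by rewrite diffeo_invK.
Qed.

(* F_* X *)
Definition push_vfield (X : vfield M) : vfield N := VField (push_vfield_proof X).

End Pushforward.

(* F_* alpha = (F^-1)^* alpha *)
Definition push_form1 (R : realType) (M N : smooth_space R) (F : diffeo M N)
    (alpha : vfield M -> smooth_fun M) : vfield N -> smooth_fun N := fun Y =>
  pull_fun (diffeo_inv_smooth F) (alpha (push_vfield (diffeo_sym F) Y)).

Section Product.
Context (R : realType) (M N : smooth_space R).

Definition prod_chart (c : chart R M (space_dim M))
    (d : chart R N (space_dim N)) :
    chart R (M * N)%type (space_dim M + space_dim N) :=
  Chart (chart_dom c `*` chart_dom d)
    (fun p => row_mx (chart_map c p.1) (chart_map d p.2))
    (fun v => (chart_inv c (lsubmx v), chart_inv d (rsubmx v))).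

Definition prod_space : smooth_space R :=
  @Space R (M * N)%type (space_dim M + space_dim N)
    [set prod_chart cd.1 cd.2 | cd in atlas (s := M) `*` atlas (s := N)].
End Product.

Section Circle.
Context (R : realType).

Definition circle_rel0 (x y : R) : bool :=
  `[< exists k : int, x - y = k%:~R * (2 * pi) >].

Lemma circle_rel0_refl : reflexive circle_rel0.
Proof. by move=> x; apply/asboolP; exists 0; rewrite mul0r subrr. Qed.

Lemma circle_rel0_sym : symmetric circle_rel0.
Proof.
have H x y : circle_rel0 x y -> circle_rel0 y x.
  move=> /asboolP[k e]; apply/asboolP; exists (- k).
  by rewrite -opprB e rmorphN mulNr.
by move=> x y; apply/idP/idP; exact: H.
Qed.

Lemma circle_rel0_trans : transitive circle_rel0.
Proof.
move=> y x z /asboolP[k e] /asboolP[l h]; apply/asboolP; exists (k + l).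
by rewrite rmorphD mulrDl -e -h addrA subrK.
Qed.

Definition circle_rel : equiv_rel R :=
  EquivRel circle_rel0 circle_rel0_refl circle_rel0_sym circle_rel0_trans.

Local Open Scope quotient_scope.
Definition circle_top : topologicalType :=
  quotient_topology {eq_quot circle_rel}.

(* The point of R / 2 pi Z with coordinate t. *)
Definition circle_pt (t : R) : circle_top :=
  (\pi_(quotient_topology {eq_quot circle_rel}) t).

(* The chart ]a, a + 2 pi[ + 2 pi Z -> ]a, a + 2 pi[ *)
Definition circle_chart (a : R) : chart R circle_top 1 :=
  Chart (circle_pt @` `]a, a + 2 * pi[)
    (fun p => const_mx
      (xget 0 [set t | (a < t < a + 2 * pi) /\ circle_pt t = p]))
    (fun v => circle_pt (v 0 0)).

Definition circle : smooth_space R := @Space R circle_top 1 (range circle_chart).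

(* Y = d/dt on N x S^1. *)
Definition is_ddt (N : smooth_space R) (Y : vfield (prod_space N circle)) :=
  forall (u : smooth_fun (prod_space N circle)) (n : N) (t : R),
    is_derive t 1 (fun s => u (n, circle_pt s) : R) (Y u (n, circle_pt t)).

(* alpha = dt on N x S^1: the coordinate t is not a global function, but
   dt is determined by dv = v'(t) dt for all smooth functions v of t. *)
Definition is_dt (N : smooth_space R)
    (alpha : vfield (prod_space N circle) -> smooth_fun (prod_space N circle)) :=
  forall (v : smooth_fun circle) (w : smooth_fun (prod_space N circle)),
    (forall p, w p = v p.2) ->
    forall (Y : vfield (prod_space N circle)) (n : N) (t : R),
    d0 w Y (n, circle_pt t) =
    derive1 (fun s : R => v (circle_pt s) : R) t * alpha Y (n, circle_pt t).
End Circle.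

(* Main.v *)
(* On a Vaisman manifold with |theta| = 1 the identity
   2 g((nabla_X J) Y, Z) = dOmega(X, Y, Z) - dOmega(X, JY, JZ), valid when the
   Nijenhuis tensor vanishes, gives nabla_B J = 0, and then
   Omega = - d(J theta) + theta /\ J theta. If u is the pullback of a function G
   on the circle, then d^c_theta' u = (G' - (1 + F) G) J theta, so u is a
   potential as soon as G' = (1 + F) G - 1. As 1 + F > 0, this linear equation
   has exactly one periodic solution, and it is positive. *)

Require Import Defs.
From HB Require Import structures.
From mathcomp Require Import all_boot all_order all_algebra.
From mathcomp Require Import all_classical all_reals all_analysis.
From mathcomp Require Import ring lra.

Set Implicit Arguments.
Unset Strict Implicit.
Unset Printing Implicit Defensive.

Import Order.TTheory GRing.Theory Num.Theory.
Import numFieldNormedType.Exports.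
Local Open Scope classical_set_scope.
Local Open Scope ring_scope.

(** * Linear periodic differential equations *)

(** The primitive is the integral from 0 to [t]. As [I a t] has derivative [f t] only for [a < t],
    it is written as a difference of two integrals from a base point [low t] to the left of both 0
    and [t]; by Chasles' relation the base does not matter. *)
Lemma continuous_primitive (R : realType) (f : R -> R) :
  continuous f -> exists P : R -> R, forall t : R, is_derive t (1 : R) P (f t).
Proof.
move=> cf; pose mu := @lebesgue_measure R.
have intf a b : mu.-integrable `[a, b] (EFin \o f).
  apply: continuous_compact_integrable; first exact: segment_compact.
  exact: continuous_subspaceT.
pose I (a t : R) : R := (\int[mu]_(s in `[a, t]) f s)%R.
have dI (a t : R) : a < t -> is_derive t (1 : R) (I a) (f t).
  move=> at_; have [d e] := @continuous_FTC1_closed R f a t (t + 1)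
    (ltr_pwDr ltr01 (lexx t)) (intf _ _) at_ (cf t).
  by apply: (DeriveDef d); rewrite -derive1E; exact: e.
have Chasles a b t : a <= b -> b <= t -> I a t = I a b + I b t.
  move=> ab bt; apply/eqP; rewrite addrC -subr_eq; apply/eqP.
  rewrite /I Rintegral_itvB ?bnd_simp//.
  apply: Rintegral_itv_obnd_cbnd.
  by apply: integrableS (intf b t) => //; exact: subset_itv_oc_cc.
pose low (t : R) := - `|t| - 1.
exists (fun t => I (low t) t - I (low t) 0) => t.
(* For [s] within distance 1 of [t] one has [c <= low s], so [c] is a common base near [t]. *)
pose c := low t - 1.
have := @is_deriveB _ _ _ _ _ _ _ _ _ (dI c t _) (is_derive_cst (I c 0) t (1 : R)).
rewrite subr0 => d; apply: near_eq_is_derive (d _); last first.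
  by rewrite /c /low; have := ler_norm (- t); rewrite normrN; lra.
near=> s.
have st : `|t - s| < 1 by near: s; exact: cvgr_dist_lt.
have [h1 h2 h3] : [/\ c <= low s, low s <= s & low s <= 0].
  have := ler_distD t s 0; rewrite !subr0 (distrC s t) => ts.
  by have := normr_ge0 s; have := ler_norm (- s); rewrite normrN /c /low; split; lra.
rewrite !fctE /= (Chasles c (low s) s)// (Chasles c (low s) 0)//; lra.
Unshelve. all: by end_near. Qed.

Lemma derive_gt0_lt (R : realType) (f f' : R -> R) :
  (forall t : R, is_derive t (1 : R) f (f' t)) -> (forall t, 0 < f' t) ->
  forall s t, s < t -> f s < f t.
Proof.
move=> df f'_gt0 s t st.
have df1 x : derivable f x 1 by case: (df x).
apply: (@gtr0_derive1_incr _ f s t) => // [x _|].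
  by rewrite derive1E; have [_ ->] := df x.
by apply: derivable_within_continuous => x _.
Qed.

(* The solution is [t |-> exp (H t) * (K - E t)] with [H' = h] and
   [E' = exp (- H)]; the constant [K] makes it periodic. *)
Lemma periodic_ode (R : realType) (h : R -> R) (T : R) :
  continuous h -> (forall t, 0 < h t) -> 0 < T -> (forall t, h (t + T) = h t) ->
  exists G : R -> R,
    [/\ forall t : R, is_derive t (1 : R) G (h t * G t - 1),
        forall t, G (t + T) = G t & forall t, 0 < G t].
Proof.
move=> ch h_gt0 T_gt0 hT.
have [H dH] := continuous_primitive ch.
have dm t : is_derive t (1 : R) (expR \o (- H)) (- h t * expR (- H t)).
  have d1 : is_derive t (1 : R) (- H) (- h t) by exact: is_deriveN.
  have d2 := is_derive_expR (- H t).
  by apply: is_derive_eq (@is_derive1_comp _ expR (- H) _ _ _ d2 d1) _; rewrite mulrC.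
have [E dE] : exists E : R -> R, forall t, is_derive t (1 : R) E (expR (- H t)).
  apply: continuous_primitive => t.
  by apply: differentiable_continuous; apply/derivable1_diffP; case: (dm t).
have H_lt := derive_gt0_lt dH h_gt0.
pose q := expR (H T - H 0).
have q_gt1 : 1 < q by rewrite expR_gt1 subr_gt0; exact: H_lt.
(* [K] solves [G T = G 0], which after division by [expR (H 0)] reads [q * (K - E T) = K - E 0];
   [1 < q] makes it solvable. *)
pose K := (q * E T - E 0) / (q - 1).
have KE : q * (K - E T) = K - E 0.
  by rewrite /K; field; rewrite subr_eq0 gt_eqF.
pose G := (expR \o H) * (cst K - E).
have GE t : G t = expR (H t) * (K - E t) by [].
have dK t : is_derive t (1 : R) (cst K - E) (- expR (- H t)).
  by apply: is_derive_eq (is_deriveB (is_derive_cst K t 1) (dE t)) _; rewrite sub0r.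
have dG t : is_derive t (1 : R) G (h t * G t - 1).
  have dexp : is_derive t (1 : R) (expR \o H) (expR (H t) * h t).
    exact: (@is_derive1_comp _ expR H _ _ _ (is_derive_expR (H t)) (dH t)).
  apply: is_derive_eq (is_deriveM dexp (dK t)) _.
  rewrite /GRing.scale /= GE mulrN -expRD subrr expR0.
  rewrite -[(cst K - E) t]/(K - E t); ring.
have mG t : expR (- H t) * G t = K - E t.
  by rewrite GE mulrA -expRD addNr expR0 mul1r.
have dshift (f f' : R -> R) : (forall t, is_derive t (1 : R) f (f' t)) ->
    forall t, is_derive t (1 : R) (f \o (id + cst T)) (f' (t + T)).
  move=> df t.
  have d1 : is_derive t (1 : R) (id + cst T) 1.
    apply: is_derive_eq (is_deriveD (is_derive_id t 1) (is_derive_cst T t 1)) _.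
    by rewrite addr0.
  apply: is_derive_eq (@is_derive1_comp _ f (id + cst T) _ _ _ (df (t + T)) d1) _.
  by rewrite mulr1.
have G_per t : G (t + T) = G t.
  (* The shift of [G] by [T] solves the same equation, so the difference times the integrating
     factor [expR (- H)] is constant; it vanishes at 0 by the choice of [K]. *)
  pose D : R -> R := (expR \o (- H)) * (G \o (id + cst T) - G).
  have dD s : is_derive s (1 : R) D 0.
    apply: is_derive_eq (is_deriveM (dm s) (is_deriveB (dshift _ _ dG s) (dG s))) _.
    rewrite /GRing.scale /= hT.
    rewrite -[((G \o (id + cst T)) - G) s]/(G (s + T) - G s); ring.
  have DE s : D s = expR (- H s) * (G (s + T) - G s) by [].
  have D0 : D 0 = 0.
    rewrite DE !GE add0r -[X in X - _](_ : expR (H 0) * (q * (K - E T)) = _).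
      by rewrite KE subrr mulr0.
    by rewrite mulrA -expRD addrC subrK.
  have /eqP := is_derive_0_is_cst t 0 dD.
  by rewrite D0 DE mulf_eq0 expR_eq0 /= subr_eq0 => /eqP.
exists G; split=> // t.
(* [expR (- H) * G = K - E] strictly decreases over a period while [G] returns to its value, so
   [(expR (- H t) - expR (- H (t + T))) * G t] is positive; its first factor is positive because [H]
   increases. *)
have : K - E (t + T) < K - E t.
  by rewrite ltrD2l ltrN2 (derive_gt0_lt dE) ?ltrDl// => s; exact: expR_gt0.
rewrite -!mG G_per -subr_gt0 -mulrBl pmulr_rgt0// subr_gt0 ltr_expR ltrN2.
by apply: H_lt; rewrite ltrDl.
Qed.

(** * Functions on the circle *)

(** A directional derivative sees only the restriction to a line; this carries derivatives from [R]
    to row vectors. *)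
Lemma is_derive_line (R : realType) (V V' : normedModType R) (f : V -> R)
    (f' : V' -> R) (x v : V) (x' v' : V') (d : R) :
  (forall h : R, f (h *: v + x) = f' (h *: v' + x')) ->
  is_derive x v f d -> is_derive x' v' f' d.
Proof.
move=> ff' df.
have e : (fun h : R => h^-1 *: ((f' \o shift x') (h *: v') - f' x')) =
         (fun h : R => h^-1 *: ((f \o shift x) (h *: v) - f x)).
  apply/funext => h /=; have := ff' 0; rewrite !scale0r !add0r => ->.
  by rewrite ff'.
case: df => df1 df2; apply: DeriveDef; first by rewrite /derivable e.
by rewrite /derive e.
Qed.

Section Coordinate.
Context (R : realType) (n : nat) (j : 'I_n).

Lemma is_derive_coord (i : 'I_n) (G : R -> R) (x : 'rV[R]_n) (d : R) :
  is_derive (x 0 j) (1 : R) G d ->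
  is_derive x (delta_mx 0 i) (fun v : 'rV[R]_n => G (v 0 j)) ((i == j)%:R * d).
Proof.
have [->|/negPf ij] := eqVneq i j; rewrite ?mul1r ?mul0r => dG.
  apply: is_derive_line dG => h; congr G.
  by rewrite !mxE !eqxx.
apply: is_derive_line (is_derive_cst (G (x 0 j)) x (delta_mx 0 i)) => h.
by rewrite !mxE eq_sym ij andbF mulr0 add0r.
Qed.

(** Bootstrap: the equation expresses the derivative of [G] through [F] and [G], so each order of
    regularity of [G] yields the next one. *)
Lemma Ck_ode (F G : R -> R) (x : 'rV[R]_n) :
  (forall k, Ck k (fun v => F (v 0 j)) x) ->
  (forall t : R, is_derive t (1 : R) G ((1 + F t) * G t - 1)) ->
  forall k, Ck k (fun v => G (v 0 j)) x.
Proof.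
move=> F_smooth dG.
have cG (y : 'rV[R]_n) : {for y, continuous (fun v : 'rV[R]_n => G (v 0 j))}.
  apply: (@continuous_comp _ _ _ (fun v : 'rV[R]_n => v 0 j)).
    exact: coord_continuous.
  by apply: differentiable_continuous; apply/derivable1_diffP; case: (dG (y 0 j)).
have dGj i (y : 'rV[R]_n) := @is_derive_coord i G y _ (dG (y 0 j)).
elim=> [|k IH]; split; try exact: filterE.
- by [].
- move=> i; split; first by apply: filterE => y; case: (dGj i y).
  apply: Ck_ext (CkM (Ck_cst k (i == j)%:R x)
    (CkD (CkM (CkD (Ck_cst k 1 x) (F_smooth k)) IH) (Ck_cst k (- 1) x))).
  by apply: filterE => y; case: (dGj i y).
Qed.

End Coordinate.

Section CircleFunctions.
Context (R : realType).

Lemma circle_ptP (s t : R) :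
  circle_pt s = circle_pt t <-> exists k : int, s - t = k%:~R * (2 * pi).
Proof.
rewrite -[circle_pt s]/(\pi_{eq_quot circle_rel R} s)%qT.
rewrite -[circle_pt t]/(\pi_{eq_quot circle_rel R} t)%qT.
by split=> [/eqmodP/asboolP|st] //; apply/eqmodP/asboolP.
Qed.

Lemma circle_pt_surj (p : circle R) : exists t : R, p = circle_pt t.
Proof. by exists (repr p); rewrite /circle_pt reprK. Qed.

Lemma circle_lift (G : R -> R) : (forall t, G (t + 2 * pi) = G t) ->
  exists Gc : circle R -> R, forall t, Gc (circle_pt t) = G t.
Proof.
move=> G_per; exists (fun p : circle R => G (repr p)) => t.
have Gn (m : nat) s : G (s + m%:R * (2 * pi)) = G s.
  elim: m => [|m IH]; first by rewrite mul0r addr0.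
  by rewrite -natr1 mulrDl mul1r addrA G_per.
have /circle_ptP[k] : circle_pt (repr (circle_pt t)) = circle_pt t.
  by rewrite /circle_pt reprK.
move=> /(canRL (subrK _)) ->; case: k => m.
  by rewrite addrC Gn.
by rewrite NegzE rmorphN mulNr -[in RHS](subrK (m.+1%:R * (2 * pi)) t) Gn addrC.
Qed.

Lemma circle_chart_img (a t : R) : a < t < a + 2 * pi ->
  chart_img (M := circle R) (circle_chart a) (const_mx t).
Proof.
move=> att; exists (circle_pt t); first by exists t; rewrite //= in_itv.
rewrite /=; congr const_mx.
have /(_ (ex_intro _ t (conj att erefl))) := @xgetPex _ 0
  [set s | (a < s < a + 2 * pi) /\ circle_pt s = circle_pt t].
set s := xget _ _ => -[ast /circle_ptP[k sk]].
have pi0 : 0 < 2 * pi :> R by rewrite mulr_gt0// pi_gt0.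
(* Both parameters lie in the same open interval of length [2 * pi], so they differ by less than a
   period and [k] must be 0. *)
have k0 : `|k%:~R * (2 * pi) : R| < 1 * (2 * pi).
  by rewrite -sk mul1r ltr_norml; move: att ast => /andP[? ?] /andP[? ?]; lra.
move: k0; rewrite normrM (gtr0_norm pi0) ltr_pM2r// -intr_norm ltrz1.
case: k sk => [[|m]|m] // sk _.
by apply/eqP; rewrite -subr_eq0 sk mul0r.
Qed.

Lemma circle_fun_continuous (F : smooth_fun (circle R)) :
  continuous (fun t => F (circle_pt t) : R).
Proof.
move=> t; have pi0 : 0 < pi :> R := pi_gt0 R.
have It : t - pi < t < t - pi + 2 * pi by apply/andP; split; lra.
have F_smooth : smooth (M := circle R) F by exact: smooth_funP.
have [/nbhs_singleton cF _] :=
  F_smooth _ (imageT (@circle_chart R) (t - pi)) _ (circle_chart_img It) 0.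
have c1 : {for t, continuous (fun s : R => const_mx s : 'rV[R]_1)}.
  move=> A /= /nbhs_ballP[e /= e0 eA].
  apply/nbhs_ballP; exists e => //= s ts; apply: eA; split=> // i k.
  by rewrite !mxE.
have e : (F \o chart_inv (circle_chart (t - pi))) \o (fun s : R => const_mx s) =
    (fun s : R => F (circle_pt s)) by apply/funext => s /=; rewrite mxE.
by have := continuous_comp c1 cF; rewrite e.
Qed.

End CircleFunctions.

(** * Pulling functions back from the circle to [M] *)

Section CirclePullback.
Context (R : realType) (M N : smooth_space R).
Context (theta : vfield M -> smooth_fun M).
Context (Psi : diffeo M (prod_space N (circle R))).
Hypothesis theta_dt : is_dt (push_form1 Psi theta).

(** This is [theta_dt] transported to [M]: pushing [Y] forward by [Psi] and back again returns
    [Y]. *)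
Lemma vfield_circle_pullback (v : smooth_fun (circle R)) (u : smooth_fun M) :
  (forall x, u x = v (Psi x).2) ->
  forall (Y : vfield M) (x : M) (t : R), (Psi x).2 = circle_pt t ->
  Y u x = derive1 (fun s : R => v (circle_pt s) : R) t * theta Y x.
Proof.
move=> uv Y x t xt.
pose w := pull_fun (diffeo_inv_smooth Psi) u.
have wv p : w p = v p.2 by rewrite /w /= uv diffeo_invK.
have := theta_dt wv (push_vfield Psi Y) (Psi x).1 t.
rewrite -xt -surjective_pairing /d0 /push_form1 /= diffeo_funK.
have -> : push_vfield (diffeo_sym Psi) (push_vfield Psi Y) = Y.
  apply/vfield_eqP => f; apply/smooth_fun_eqP => y /=; rewrite diffeo_funK.
  by congr (Y _ _); apply/smooth_fun_eqP => z /=; rewrite diffeo_funK.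
suff -> : pull_fun (diffeo_smooth Psi) w = u by [].
by apply/smooth_fun_eqP => z /=; rewrite diffeo_funK.
Qed.

Lemma potential_of_circle_fun (F : smooth_fun (circle R)) (f : smooth_fun M) :
  (forall s, -1 < F s) -> (forall x, f x = F (Psi x).2) ->
  exists2 u : smooth_fun M, (forall x, 0 < u x) &
    forall Y : vfield M, Y u = ((1 + f) * u - 1) * theta Y.
Proof.
move=> F_gt fF; pose Ft (t : R) : R := F (circle_pt t).
have [||||G [dG G_per G_gt0]] := @periodic_ode R (fun t => 1 + Ft t) (2 * pi).
- move=> t; apply: (@continuousD _ R^o _ (cst 1) Ft).
    exact: cst_continuous.
  exact: (@circle_fun_continuous R F t).
- by move=> t; rewrite -ltrBlDl sub0r; exact: F_gt.
- by rewrite mulr_gt0// pi_gt0.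
- move=> t; rewrite /Ft; congr (1 + F _); apply/circle_ptP; exists 1.
  by rewrite addrAC subrr add0r mul1r.
have [Gc GcE] := circle_lift G_per.
have Gc_smooth : smooth (M := circle R) Gc.
  move=> _ [a _ <-] v va k.
  have -> : Gc \o chart_inv (circle_chart a) = (fun v : 'rV[R]_1 => G (v 0 0)).
    by apply/funext => y; rewrite /= GcE.
  apply: (@Ck_ode R 1 0 Ft) => // l.
  exact: (smooth_funP F (imageT (@circle_chart R) a) va l).
pose v := SmoothFun (asboolT Gc_smooth).
(* Regularity is again read off the equation, now in the last coordinate of a product chart. The
   coefficient is smooth there because it is [f] transported by the inverse of [Psi]. *)
have w_smooth : smooth (M := prod_space N (circle R)) (fun p => Gc p.2).
  move=> _ [[c d] /= [Ac [a _ <-]] <-] y yc k.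
  have coordE (x : 'rV[R]_(space_dim N + 1)) : rsubmx x 0 0 = x 0 (rshift _ 0).
    by rewrite mxE.
  have -> : (fun p => Gc p.2) \o chart_inv (@prod_chart R N (circle R) c (circle_chart a)) =
      (fun v : 'rV[R]_(space_dim N + 1) => G (v 0 (rshift _ 0))).
    by apply/funext => x; rewrite /= GcE coordE.
  apply: (@Ck_ode R _ _ Ft) => // l.
  have /asboolP fs := smooth_valP (pull_fun (diffeo_inv_smooth Psi) f).
  have Acd : atlas (s := prod_space N (circle R))
      (@prod_chart R N (circle R) c (circle_chart a)).
    by exists (c, circle_chart a) => //; split => //; exists a.
  have := fs _ Acd _ yc l; apply: Ck_ext; apply: filterE => x.
  by rewrite /= fF diffeo_invK /= /Ft coordE.
have u_smooth : smooth (fun x => Gc (Psi x).2).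
  exact: (diffeo_smooth Psi (SmoothFun (asboolT w_smooth))).
pose u := SmoothFun (asboolT u_smooth).
exists u => [x|Y].
  by have [t xt] := circle_pt_surj (Psi x).2; rewrite /= xt GcE.
apply/smooth_fun_eqP => x; have [t xt] := circle_pt_surj (Psi x).2.
rewrite (vfield_circle_pullback (v := v) _ _ xt)//=.
have -> : (fun s => Gc (circle_pt s)) = G by apply/funext => s; rewrite GcE.
rewrite derive1E; have [_ ->] := dG t.
rewrite -[RHS]/(((1 + f x) * Gc (Psi x).2 - 1) * theta Y x).
by rewrite fF xt GcE.
Qed.

End CirclePullback.

(** * Deformation of a Vaisman structure *)

Section SmoothForms.
Context (R : realType) (M : smooth_space R).
Implicit Types (u v : smooth_fun M) (x : M).

Lemma smooth_fun_evalD u v x : (u + v) x = u x + v x. Proof. by []. Qed.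
Lemma smooth_fun_evalM u v x : (u * v) x = u x * v x. Proof. by []. Qed.
Lemma smooth_fun_evalN u x : (- u) x = - u x. Proof. by []. Qed.
Lemma smooth_fun_eval0 x : (0 : smooth_fun M) x = 0. Proof. by []. Qed.
Lemma smooth_fun_eval1 x : (1 : smooth_fun M) x = 1. Proof. by []. Qed.

Definition smooth_fun_evalE := (smooth_fun_evalD, smooth_fun_evalM,
  smooth_fun_evalN, smooth_fun_eval0, smooth_fun_eval1).

Lemma vfieldD (X : vfield M) u v : X (u + v) = X u + X v.
Proof. by have [Xl _] := vfieldP X; have := Xl 1 u v; rewrite !scale1r. Qed.

Lemma vfield0 (X : vfield M) : X 0 = 0.
Proof. by apply: (addrI (X 0)); rewrite -vfieldD !addr0. Qed.

Lemma vfieldN (X : vfield M) u : X (- u) = - X u.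
Proof. by apply/eqP; rewrite -addr_eq0 -vfieldD addNr vfield0. Qed.

Lemma vfieldM (X : vfield M) u v : X (u * v) = X u * v + u * X v.
Proof. by have [_ ->] := vfieldP X. Qed.

Lemma vfield_1 (X : vfield M) : X 1 = 0.
Proof.
have := vfieldM X 1 1; rewrite !mulr1 mul1r => /eqP.
by rewrite -subr_eq0 opprD addNKr oppr_eq0 => /eqP.
Qed.

Lemma d1_scale u (alpha : vfield M -> smooth_fun M) Y Z :
  d1 (fun V => u * alpha V) Y Z = wedge11 (d0 u) alpha Y Z + u * d1 alpha Y Z.
Proof. by rewrite /d1 /wedge11 /d0 !vfieldM; ring. Qed.

(** The Leibniz rule for [alpha /\ beta], where the term in [d alpha] drops out. *)
Lemma d2_wedge_closed (alpha beta : vfield M -> smooth_fun M) :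
  (forall Y Z, d1 alpha Y Z = 0) -> forall Y Z T,
  d2 (wedge11 alpha beta) Y Z T = - wedge12 alpha (d1 beta) Y Z T.
Proof.
move=> da Y Z T.
have e V W : alpha (lie V W) = V (alpha W) - W (alpha V).
  by have /eqP := da V W; rewrite subr_eq0 => /eqP.
rewrite /d2 /wedge11 /wedge12 /d1 !vfieldD !vfieldN !vfieldM !e; ring.
Qed.

End SmoothForms.

Section Vaisman.
Context (R : realType) (M : smooth_space R) (J : vfield M -> vfield M).
Context (g : vfield M -> vfield M -> smooth_fun M).
Context (theta : vfield M -> smooth_fun M) (B : vfield M).
Hypotheses (J_complex : is_complex_structure J) (M_lck : is_lck J g theta).
Hypotheses (B_dual : metric_dual g theta B) (theta_unit : g B B = 1).

Let J_linear : linear J. Proof. by case: J_complex. Qed.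
Let theta_linear : scalar theta. Proof. by case: M_lck. Qed.
Let g_bilinear : is_bilinear g. Proof. by case: M_lck => -[[]]. Qed.

HB.instance Definition _ := GRing.isLinear.Build _ _ _ _ J J_linear.
HB.instance Definition _ := GRing.isLinear.Build _ _ _ _ theta theta_linear.
HB.instance Definition _ Y := GRing.isLinear.Build _ _ _ _ (g Y) (g_bilinear.1 Y).

Let JJ Y : J (J Y) = - Y. Proof. by case: J_complex. Qed.
Let gC Y Z : g Y Z = g Z Y. Proof. by case: M_lck => -[[]]. Qed.
Let gJJ Y Z : g (J Y) (J Z) = g Y Z. Proof. by case: M_lck => -[]. Qed.
Let gDl Y Z T : g (Y + Z) T = g Y T + g Z T. Proof. by rewrite !(gC _ T) raddfD. Qed.
Let gNl Y Z : g (- Y) Z = - g Y Z. Proof. by rewrite !(gC _ Z) raddfN. Qed.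
Let gJl Y Z : g (J Y) Z = - g Y (J Z).
Proof. by rewrite -gJJ JJ gNl. Qed.
Let thetaB : theta B = 1. Proof. by rewrite -B_dual. Qed.
Let thetaJB : theta (J B) = 0.
Proof.
apply/smooth_fun_eqP => x.
have := congr1 (fun u : smooth_fun M => u x) (gJl B B).
by rewrite gC !B_dual !smooth_fun_evalE => ?; lra.
Qed.

(** * The covariant derivative of [J] *)

Section Parallel.
Context (nabla : vfield M -> vfield M -> vfield M).
Hypotheses (nablaLC : is_levi_civita g nabla).
Hypothesis theta_parallel : forall Y Z : vfield M, Y (theta Z) - theta (nabla Y Z) = 0.

Let nablaD Y Z T : nabla Y (Z + T) = nabla Y Z + nabla Y T.
Proof. by case: nablaLC. Qed.
Let nablaN Y Z : nabla Y (- Z) = - nabla Y Z.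
Proof.
have e0 : nabla Y 0 = 0 by apply: (addrI (nabla Y 0)); rewrite -nablaD !addr0.
by apply/eqP; rewrite -addr_eq0 -nablaD addNr e0.
Qed.
Let lieE Y Z : lie Y Z = nabla Y Z - nabla Z Y.
Proof. by case: nablaLC. Qed.
Let nabla_g (Y Z T : vfield M) : Y (g Z T) = g (nabla Y Z) T + g Z (nabla Y T).
Proof. by case: nablaLC. Qed.

(** [DJ X Y] is [(nabla_X J) Y], and [A X Y Z] is the covariant derivative of the fundamental form,
    [(nabla_X Omega)(Y, Z)]. *)
Let DJ X Y := nabla X (J Y) - J (nabla X Y).
Let A X Y Z := g (DJ X Y) Z.

(** [J] is skew for [g] and [nabla] is metric, so [nabla_X J] is skew. *)
Let A_anti X Y Z : A X Y Z = - A X Z Y.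
Proof.
have e : X (g (J Y) Z) = - X (g Y (J Z)) by rewrite gJl vfieldN.
move: e; rewrite !nabla_g /A /DJ !gDl !gNl => e.
rewrite !(gJl (nabla _ _)) (gC (J Y)) (gC Y) in e *.
apply/smooth_fun_eqP => x.
have := congr1 (fun u : smooth_fun M => u x) e.
by rewrite !smooth_fun_evalE => ?; lra.
Qed.

(** Differentiating [J^2 = -1] shows that [nabla_X J] anticommutes with [J]; skewness of [J] then
    moves it to [Z]. *)
Let A_J X Y Z : A X (J Y) Z = A X Y (J Z).
Proof.
rewrite /A /DJ JJ nablaN !gDl !gNl gJJ (gJl (nabla X (J Y))); ring.
Qed.

(** For a torsion-free connection, the exterior derivative is the cyclic sum of the covariant
    derivative. *)
Let dOmega Y Z T :
  d2 (fundamental_form J g) Y Z T = A Y Z T + A Z T Y + A T Y Z.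
Proof.
rewrite (A_anti Z T) /d2 /fundamental_form !lieE !nabla_g !raddfB /= !gDl !gNl.
rewrite !(gJl _ (nabla _ _)) !(gC _ (J (nabla _ _))) /A /DJ !gDl !gNl; ring.
Qed.

(** The Nijenhuis tensor with brackets expanded through the torsion-free [nabla], paired with
    [J X]. *)
Let nijenhuis Y Z X :
  A (J Y) Z (J X) - A (J Z) Y (J X) + A Z Y X - A Y Z X = 0.
Proof.
have [_ _ N0] := J_complex.
have := congr1 (fun V => g V (J X)) (N0 Y Z).
rewrite !lieE !raddfB /= !gDl !gNl (gC 0) raddf0 => <-.
rewrite /A /DJ !gDl !gNl !gJJ -!(gJJ (J (nabla _ _)) X) !JJ !gNl; ring.
Qed.

Let A_B Y Z : A B Y Z = 0.
Proof.
(* [2 A B Y Z] is dOmega(B, Y, Z) - dOmega(B, JY, JZ), and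
   dOmega(B, _, _) = (theta /\ Omega)(B, _, _) is J-invariant. *)
have [_ _ _ dO] := M_lck.
have h1 := esym (dOmega B Y Z); have h2 := esym (dOmega B (J Y) (J Z)).
have h3 := nijenhuis Y Z B.
move: h1 h2; rewrite !dO /wedge12 /fundamental_form !gJJ.
rewrite !(gJl B) !B_dual thetaB (A_J B Y) (A_J (J Y)) JJ => h1 h2.
rewrite [A (J Z) B _]A_anti A_J in h2.
rewrite [A B Y (- Z)]raddfN in h2.
apply/smooth_fun_eqP => x.
have := congr1 (fun u : smooth_fun M => u x) (A_anti Z B Y).
move: (congr1 (fun u : smooth_fun M => u x) h1).
move: (congr1 (fun u : smooth_fun M => u x) h2).
move: (congr1 (fun u : smooth_fun M => u x) h3).
by rewrite !smooth_fun_evalE => *; lra.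
Qed.

(** Evaluate [dOmega = theta /\ Omega] at [(B, Y, Z)]. The right side is [Omega - theta /\ J theta],
    because [Omega(B, _) = J theta]. On the left [A B Y Z] vanishes, and since [theta] is parallel,
    [A X V B] is minus the covariant derivative of [J theta]; antisymmetrising gives
    [- d(J theta)]. *)
Lemma vaisman_fundamental_form Y Z : fundamental_form J g Y Z =
  - d1 (actJ J theta) Y Z + wedge11 theta (actJ J theta) Y Z.
Proof.
have [_ _ _ dO] := M_lck.
have := dOmega B Y Z; rewrite dO A_B (A_anti Z) /wedge12 /fundamental_form.
rewrite !(gJl B) !B_dual thetaB mul1r add0r => e.
have thetaN (X V : vfield M) : X (theta V) = theta (nabla X V).
  by apply/eqP; rewrite -subr_eq0 theta_parallel.
have AE X V : A X V B = theta (nabla X (J V)) - theta (J (nabla X V)).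
  by rewrite /A gC B_dual raddfB.
move: e; rewrite !AE /d1 /wedge11 /actJ !vfieldN !thetaN lieE !raddfB /= => e.
apply/smooth_fun_eqP => x; have := congr1 (fun u : smooth_fun M => u x) e.
by rewrite !smooth_fun_evalE => ?; lra.
Qed.
End Parallel.

(** * The deformed metric, its Lee form and its potential *)

Context (f : smooth_fun M).
Hypotheses (f_gt : forall x, -1 < f x) (df : forall Y : vfield M, Y f = B f * theta Y).
Hypothesis omegaE : forall Y Z, fundamental_form J g Y Z =
  - d1 (actJ J theta) Y Z + wedge11 theta (actJ J theta) Y Z.

(** The metric is scaled by [1 + f] on the span of [B] and [J B] and kept on the orthogonal
    complement. *)
Definition deformed_metric (Y Z : vfield M) : smooth_fun M :=
  g Y Z + f * (theta Y * theta Z + theta (J Y) * theta (J Z)).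

Definition deformed_form (Y Z : vfield M) : smooth_fun M :=
  fundamental_form J g Y Z + f * wedge11 theta (actJ J theta) Y Z.

Lemma deformed_formE Y Z :
  fundamental_form J deformed_metric Y Z = deformed_form Y Z.
Proof.
rewrite /fundamental_form /deformed_metric /deformed_form /wedge11 /actJ JJ.
by rewrite raddfN /fundamental_form; ring.
Qed.

(* Bessel's inequality for the orthonormal pair [B], [J B]. *)
Lemma theta_bessel Y x : theta Y x ^+ 2 + theta (J Y) x ^+ 2 <= g Y Y x.
Proof.
have [[[_ _ g_ge0 _] _] _ _ _] := M_lck.
(* [W] is the part of [Y] orthogonal to [B] and [J B]; the plus sign comes from
   [g Y (J B) = - theta (J Y)]. *)
pose W := Y - theta Y *: B + theta (J Y) *: J B.
have gWW : g W W = g Y Y - theta Y * theta Y - theta (J Y) * theta (J Y).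
  rewrite {2}/W linearD linearB !linearZ /= !(gC W) /W !linearD !linearN !linearZ /=.
  rewrite !(gC Y) !(gC (J B) B) gJJ !(gJl B) !B_dual thetaB thetaJB; ring.
have := g_ge0 W x; rewrite gWW !smooth_fun_evalE => ?; lra.
Qed.

(** Let [b] be the sum of the squares of [theta Y] and [theta (J Y)]. Since [b <= g Y Y], the new
    square norm [g Y Y + f * b] is at least [(1 + f) * b >= 0]. If it vanishes then [b = 0], hence
    [g Y Y = 0]. *)
Lemma deformed_metric_hermitian : is_hermitian J deformed_metric.
Proof.
have [[[_ _ g_ge0 g_def] _] _ _ _] := M_lck.
have pos Y x : deformed_metric Y Y x =
    g Y Y x + f x * (theta Y x ^+ 2 + theta (J Y) x ^+ 2) by rewrite !expr2.
have aux (a b c : R) : b <= a -> 0 <= b -> -1 < c -> 0 <= a + c * b by nra.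
split; first split.
- split=> [Y k Z T|Z k Y T].
    rewrite /deformed_metric !linearP /=; ring.
  rewrite /deformed_metric !(gC _ Z) !linearP /=; ring.
- by move=> Y Z; rewrite /deformed_metric gC; ring.
- move=> Y x; rewrite pos; apply: aux => //; first exact: theta_bessel.
  by rewrite addr_ge0 ?sqr_ge0.
- move=> Y x; rewrite pos => e; apply: g_def.
  move: e (theta_bessel Y x) (f_gt x).
  have : 0 <= theta Y x ^+ 2 + theta (J Y) x ^+ 2 by rewrite addr_ge0 ?sqr_ge0.
  move: (g Y Y x) (_ + _) => a b b_ge0 e ba c_gt.
  have : (1 + f x) * b <= 0 by lra.
  rewrite pmulr_rle0; last by lra.
  move=> b_le0; have b0 : b = 0 by lra.
  by move: e; rewrite b0 mulr0 addr0.
- move=> Y Z; rewrite /deformed_metric gJJ !JJ !raddfN; ring.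
Qed.

(** As [df] is a multiple of [theta], the form [f theta] is closed. Substituting
    [d(J theta) = theta /\ J theta - Omega] gives [d(f theta /\ J theta) = f theta /\ Omega], and
    [theta /\ theta = 0] turns the total into [theta' /\ Omega']. *)
Lemma deformed_lck : is_lck J deformed_metric (fun Y => (1 + f) * theta Y).
Proof.
have [_ _ dtheta dO] := M_lck.
have dftheta Y Z : d1 (fun V => f * theta V) Y Z = 0.
  by rewrite d1_scale dtheta /wedge11 /d0 (df Y) (df Z); ring.
split=> [||Y Z|Y Z T].
- exact: deformed_metric_hermitian.
- by move=> k Y Z; rewrite linearP /=; ring.
- by rewrite d1_scale dtheta /wedge11 /d0 !vfieldD !vfield_1 (df Y) (df Z); ring.
- have e1 : fundamental_form J deformed_metric = fun V W =>
      fundamental_form J g V W + wedge11 (fun U => f * theta U) (actJ J theta) V W.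
    apply/funext => V; apply/funext => W; rewrite deformed_formE /deformed_form.
    by rewrite /wedge11; ring.
  have d2D (v w : vfield M -> vfield M -> smooth_fun M) :
      d2 (fun V W => v V W + w V W) Y Z T = d2 v Y Z T + d2 w Y Z T.
    by rewrite /d2 !vfieldD; ring.
  have dJ V W : d1 (actJ J theta) V W =
      wedge11 theta (actJ J theta) V W - fundamental_form J g V W.
    by rewrite omegaE; ring.
  rewrite e1 d2D dO d2_wedge_closed// /wedge12 !dJ /wedge11; ring.
Qed.

(** The equation for [u] makes its twisted [d^c] equal to [- J theta], a twisted primitive of the
    deformed form. *)
Lemma deformed_potential (u : smooth_fun M) :
  (forall x, 0 < u x) -> (forall Y : vfield M, Y u = ((1 + f) * u - 1) * theta Y) ->
  has_positive_potential J deformed_form (fun Y => (1 + f) * theta Y).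
Proof.
move=> u_gt0 du; exists u => // Y Z.
have -> : dctw J (fun V => (1 + f) * theta V) u = (fun V => - actJ J theta V).
  by apply/funext => V; rewrite /dctw /dc /actJ /d0 du; ring.
rewrite /deformed_form omegaE /dtw /d1 /wedge11 !vfieldN; ring.
Qed.

End Vaisman.

Theorem lemma2p5 (R : realType)
    (M : smooth_space R) (M_mfd : is_manifold M)
    (M_compact : compact [set: M]) (M_connected : connected [set: M])
    (J : vfield M -> vfield M) (g : vfield M -> vfield M -> smooth_fun M)
    (theta : vfield M -> smooth_fun M)
    (J_complex : is_complex_structure J) (M_vaisman : is_vaisman J g theta)
    (B : vfield M) (B_dual : metric_dual g theta B) (theta_unit : g B B = 1)
    (Phi : R -> M -> M) (Phi_flow : is_flow B Phi)
    (Phi_period : forall x, Phi (2 * pi) x = x)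
    (N : smooth_space R) (N_mfd : is_manifold N) (N_compact : compact [set: N])
    (phi : vfield N -> vfield N) (xi : vfield N)
    (eta : vfield N -> smooth_fun N) (gN : vfield N -> vfield N -> smooth_fun N)
    (N_sasaki : is_sasaki phi xi eta gN)
    (Psi : diffeo M (prod_space N (circle R)))
    (B_ddt : is_ddt (push_vfield Psi B))
    (theta_dt : is_dt (push_form1 Psi theta))
    (F : smooth_fun (circle R)) (F_nonconst : exists s t, F s <> F t)
    (F_gt : forall s, -1 < F s)
    (f : smooth_fun M) (f_F : forall x, f x = F (Psi x).2) :
  let Omega' := fun Y Z =>
    fundamental_form J g Y Z + f * wedge11 theta (actJ J theta) Y Z in
  let theta' := fun Y => (1 + f) * theta Y in
  is_lck_form J Omega' theta' /\ has_positive_potential J Omega' theta'.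
Proof.
move=> Omega' theta'; have [M_lck [nabla nablaLC theta_parallel]] := M_vaisman.
have f_gt x : -1 < f x by rewrite f_F.
have thetaB : theta B = 1 by rewrite -B_dual.
(* [Y f] is [F'(t) theta(Y)]; taking [Y = B] identifies [F'(t)] with [B f]. *)
have df (Y : vfield M) : Y f = B f * theta Y.
  apply/smooth_fun_eqP => x; have [t xt] := circle_pt_surj (Psi x).2.
  rewrite smooth_fun_evalE !(vfield_circle_pullback theta_dt f_F _ xt).
  by rewrite thetaB smooth_fun_eval1 mulr1.
have omegaE := vaisman_fundamental_form J_complex M_lck B_dual theta_unit
  nablaLC theta_parallel.
split; last first.
  have [u u_gt0 du] := potential_of_circle_fun theta_dt F_gt f_F.
  exact: (deformed_potential J_complex M_lck omegaE u_gt0 du).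
exists (deformed_metric J g theta f).
  exact: (deformed_lck J_complex M_lck B_dual theta_unit f_gt df omegaE).
exact: (deformed_formE J_complex M_lck f).
Qed.
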